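(* Let $(T,[-,-,-],\cdot)$ be a truss and let $S$ be a (non-empty) ideal of $T$. Then: (1) $S$ is a paragon. (2) The sub-heap relation $\sim_S$ is a congruence on $(T,[-,-,-],\cdot)$. (3) $S$ (viewed as an element of $T/S$) is the absorber in the quotient truss $(T/S,[-,-,-],\cdot)$.
   Context: A heap is a non-empty set $H$ with a ternary operation $[-,-,-]$ satisfying $[v,w,[x,y,z]]=[[v,w,x],y,z]$ and $[x,x,y]=y=[y,x,x]$; it is Abelian if $[x,y,z]=[z,y,x]$. A sub-heap is a (non-empty) subset closed under $[-,-,-]$. For a sub-heap $S$ of an Abelian heap $H$, the sub-heap relation is: $x\sim_S y$ iff there exists $s\in S$ with $[x,y,s]\in S$. It is an equivalence relation, $S$ is one of its classes, and $H/S$ denotes the set of classes, with heap operation $[\bar x,\bar y,\bar z]=\overline{[x,y,z]}$. A truss is an Abelian heap $T$ with an associative binary operation (juxtaposition) satisfying $w[x,y,z]=[wx,wy,wz]$ and $[x,y,z]w=[xw,yw,zw]$. A congruence is an equivalence relation compatible with both operations; the quotient truss $T/S$ has multiplication $\bar x\,\bar y=\overline{xy}$. An ideal of $T$ is a sub-heap $S$ such that $xs\in S$ and $sx\in S$ for all $x\in T$, $s\in S$. A paragon of $T$ is a sub-heap $P$ such that $[xp,xp',p']\in P$ and $[px,p'x,p']\in P$ for all $x\in T$, $p,p'\in P$. An absorber in a truss is an element $0$ with $x0=0=0x$ for all $x$. *)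

(* Defs.v *)
From HB Require Import structures.
From mathcomp Require Import ssreflect ssrfun ssrbool.
From mathcomp Require Import boolp classical_sets.

Set Implicit Arguments.
Unset Strict Implicit.
Unset Printing Implicit Defensive.

Declare Scope truss_scope.
Delimit Scope truss_scope with truss.
Local Open Scope classical_set_scope.
Local Open Scope truss_scope.

HB.mixin Record isHeap H := {
  heap_inhabited : inhabited H;
  heap_op : H -> H -> H -> H;
  heap_opA : forall v w x y z,
    heap_op v w (heap_op x y z) = heap_op (heap_op v w x) y z;
  heap_opxx : forall x y, heap_op x x y = y;
  heap_opyx : forall x y, heap_op y x x = y }.

#[short(type="heapType")]
HB.structure Definition Heap := { H of isHeap H }.

Notation "[h x , y , z ]" := (heap_op x y z)
  (at level 0, x, y, z at level 99, format "[h  x ,  y ,  z ]") : truss_scope.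

HB.mixin Record Heap_isAbelian H of Heap H := {
  heap_opC : forall x y z : H, [h x, y, z] = [h z, y, x] }.

#[short(type="abelianHeapType")]
HB.structure Definition AbelianHeap := { H of Heap H & Heap_isAbelian H }.

HB.mixin Record AbelianHeap_isTruss T of AbelianHeap T := {
  truss_mul : T -> T -> T;
  truss_mulA : associative truss_mul;
  truss_mulr : forall w x y z : T,
    truss_mul w [h x, y, z] = [h truss_mul w x, truss_mul w y, truss_mul w z];
  truss_mull : forall w x y z : T,
    truss_mul [h x, y, z] w = [h truss_mul x w, truss_mul y w, truss_mul z w] }.

#[short(type="trussType")]
HB.structure Definition Truss := { T of AbelianHeap T & AbelianHeap_isTruss T }.

Notation "x * y" := (truss_mul x y) : truss_scope.

Definition sub_heap (H : heapType) (S : set H) : Prop :=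
  S !=set0 /\ forall x y z, S x -> S y -> S z -> S [h x, y, z].

Definition sub_heap_rel (H : heapType) (S : set H) (x y : H) : Prop :=
  exists2 s, S s & S [h x, y, s].

Definition ideal (T : trussType) (S : set T) : Prop :=
  sub_heap S /\ forall x s, S s -> S (x * s) /\ S (s * x).

Definition paragon (T : trussType) (P : set T) : Prop :=
  sub_heap P /\ forall x p p', P p -> P p' ->
    P [h x * p, x * p', p'] /\ P [h p * x, p' * x, p'].

Definition absorber (T : trussType) (o : T) : Prop :=
  forall x, x * o = o /\ o * x = o.

Record congruence (T : trussType) (R : T -> T -> Prop) : Prop := Congruence {
  cong_refl : forall x, R x x;
  cong_sym : forall x y, R x y -> R y x;
  cong_trans : forall x y z, R x y -> R y z -> R x z;
  cong_heap : forall x x' y y' z z',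
    R x x' -> R y y' -> R z z' -> R [h x, y, z] [h x', y', z'];
  cong_mul : forall x x' y y', R x x' -> R y y' -> R (x * y) (x' * y') }.

Definition eqclass (T : Type) (R : T -> T -> Prop) (x : T) : set T :=
  [set y | R x y].

(* An element of the quotient is literally an equivalence class, i.e. a subset
   of T; the proof C only serves to put a truss structure on this type. *)
Definition quotient (T : trussType) (R : T -> T -> Prop) (C : congruence R)
  : Type := {A : set T | exists x, A = eqclass R x}.

Section Quotient.
Variables (T : trussType) (R : T -> T -> Prop) (C : congruence R).
Local Notation Q := (quotient C).

Lemma quotient_inj (A B : Q) : sval A = sval B -> A = B.
Proof. by case: A B => [A AP] [B BP] /= AB; apply: eq_exist. Qed.

Definition to_quotient (x : T) : Q :=
  exist _ (eqclass R x) (ex_intro _ x erefl).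

Definition repr_quotient (A : Q) : T := sval (cid (svalP A)).

Lemma repr_quotientK : cancel repr_quotient to_quotient.
Proof.
by move=> A; rewrite /repr_quotient; case: cid => x /= eAx; apply: quotient_inj.
Qed.

Lemma eq_to_quotient x y : to_quotient x = to_quotient y <-> R x y.
Proof.
split=> [[exy]|Rxy].
  have: eqclass R y y by exact: (cong_refl C).
  by rewrite -exy.
apply: quotient_inj; apply/seteqP; split=> z /= Rz.
  exact: (cong_trans C (cong_sym C Rxy) Rz).
exact: (cong_trans C Rxy Rz).
Qed.

Lemma repr_to_quotient x : R (repr_quotient (to_quotient x)) x.
Proof. by apply/eq_to_quotient; rewrite repr_quotientK. Qed.

Definition quotient_op (A B D : Q) : Q :=
  to_quotient [h repr_quotient A, repr_quotient B, repr_quotient D].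

Definition quotient_mul (A B : Q) : Q :=
  to_quotient (repr_quotient A * repr_quotient B).

Lemma quotient_opE x y z :
  quotient_op (to_quotient x) (to_quotient y) (to_quotient z) =
  to_quotient [h x, y, z].
Proof. by apply/eq_to_quotient/(cong_heap C); apply: repr_to_quotient. Qed.

Lemma quotient_mulE x y :
  quotient_mul (to_quotient x) (to_quotient y) = to_quotient (x * y).
Proof. by apply/eq_to_quotient/(cong_mul C); apply: repr_to_quotient. Qed.

Lemma quotientP (P : Q -> Prop) : (forall x, P (to_quotient x)) -> forall A, P A.
Proof. by move=> PQ A; rewrite -(repr_quotientK A). Qed.

Fact quotient_inhabited : inhabited Q.
Proof. by case: (@heap_inhabited T) => x; exists; apply: to_quotient. Qed.

Fact quotient_opA (v w x y z : Q) :
  quotient_op v w (quotient_op x y z) = quotient_op (quotient_op v w x) y z.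
Proof.
elim/quotientP: v => v; elim/quotientP: w => w; elim/quotientP: x => x.
elim/quotientP: y => y; elim/quotientP: z => z.
by rewrite !quotient_opE heap_opA.
Qed.

Fact quotient_opxx (x y : Q) : quotient_op x x y = y.
Proof.
elim/quotientP: x => x; elim/quotientP: y => y.
by rewrite quotient_opE heap_opxx.
Qed.

Fact quotient_opyx (x y : Q) : quotient_op y x x = y.
Proof.
elim/quotientP: x => x; elim/quotientP: y => y.
by rewrite quotient_opE heap_opyx.
Qed.

HB.instance Definition _ := isHeap.Build Q
  quotient_inhabited quotient_opA quotient_opxx quotient_opyx.

Lemma quotient_heapE x y z :
  [h to_quotient x, to_quotient y, to_quotient z] = to_quotient [h x, y, z].
Proof. exact: quotient_opE. Qed.

Fact quotient_opC (x y z : Q) : [h x, y, z] = [h z, y, x].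
Proof.
elim/quotientP: x => x; elim/quotientP: y => y; elim/quotientP: z => z.
by rewrite !quotient_heapE heap_opC.
Qed.

HB.instance Definition _ := Heap_isAbelian.Build Q quotient_opC.

Fact quotient_mulA : associative quotient_mul.
Proof.
move=> x y z.
elim/quotientP: x => x; elim/quotientP: y => y; elim/quotientP: z => z.
by rewrite !quotient_mulE truss_mulA.
Qed.

Fact quotient_mulr (w x y z : Q) :
  quotient_mul w [h x, y, z] =
  [h quotient_mul w x, quotient_mul w y, quotient_mul w z].
Proof.
elim/quotientP: w => w.
elim/quotientP: x => x; elim/quotientP: y => y; elim/quotientP: z => z.
by rewrite quotient_heapE !quotient_mulE quotient_heapE truss_mulr.
Qed.

Fact quotient_mull (w x y z : Q) :
  quotient_mul [h x, y, z] w =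
  [h quotient_mul x w, quotient_mul y w, quotient_mul z w].
Proof.
elim/quotientP: w => w.
elim/quotientP: x => x; elim/quotientP: y => y; elim/quotientP: z => z.
by rewrite quotient_heapE !quotient_mulE quotient_heapE truss_mull.
Qed.

HB.instance Definition _ := AbelianHeap_isTruss.Build Q
  quotient_mulA quotient_mulr quotient_mull.

Lemma quotient_trussE x y :
  to_quotient x * to_quotient y = to_quotient (x * y).
Proof. exact: quotient_mulE. Qed.

End Quotient.

(* Main.v *)
(* Being related to y by ~_S means being of the form [t, s, y] with s, t in S.
   In this form the heap operation moves t and s to the outside, and
   multiplication by z turns them into tz, sz (or zt, zs), which lie in S again
   when S is an ideal. *)
Require Import Defs.
From mathcomp Require Import ssreflect ssrfun ssrbool.
From mathcomp Require Import boolp classical_sets.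

Set Implicit Arguments.
Unset Strict Implicit.
Unset Printing Implicit Defensive.

Local Open Scope classical_set_scope.
Local Open Scope truss_scope.

(** Reading [[h a, b, c]] as [a b^-1 c] in a group, this is the rule that inverting the product
    [x y^-1 z] reverses its factors. *)
Lemma heap_op_mid (H : heapType) (v x y z w : H) :
  [h v, [h x, y, z], w] = [h [h v, z, y], x, w].
Proof.
(* Inserting the trivial pair [[h x, y, z]], [[h x, y, z]] before [w] gives both sides the same last
   two arguments; only the first ones remain to be compared. *)
rewrite -[w in RHS](heap_opxx [h x, y, z]) [RHS]heap_opA; congr [h _, _, w].
by rewrite heap_opA heap_opyx -heap_opA heap_opxx heap_opyx.
Qed.

(** The middle argument counts negatively, so a shift by [t - s] there leaves as a shift by
    [s - t]. *)
Lemma abelian_heap_op_mid (H : abelianHeapType) (x t s y z : H) :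
  [h x, [h t, s, y], z] = [h s, t, [h x, y, z]].
Proof.
by rewrite heap_op_mid -heap_opA (heap_opC s) [LHS]heap_opA [LHS]heap_opC.
Qed.

Section SubHeap.
Variables (H : heapType) (S : set H).
Hypothesis hS : sub_heap S.

Lemma sub_heap_relP (x y : H) :
  sub_heap_rel S x y <-> exists s t, [/\ S s, S t & x = [h t, s, y]].
Proof.
split=> [[s Ss St]|[s [t [Ss St ->]]]].
  (* The element [t] is forced: solving [x = [h t, s, y]] for [t] gives [[h x, y, s]]. *)
  exists s, [h x, y, s]; split=> //.
  by rewrite -heap_opA heap_opxx heap_opyx.
by exists s; rewrite // -heap_opA heap_opxx heap_opyx.
Qed.

Lemma sub_heap_rel_op (s t x : H) : S s -> S t -> sub_heap_rel S [h t, s, x] x.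
Proof. by move=> Ss St; apply/sub_heap_relP; exists s, t. Qed.

Lemma sub_heap_rel_refl (x : H) : sub_heap_rel S x x.
Proof. by have [[s Ss] _] := hS; exists s; rewrite ?heap_opxx. Qed.

Lemma sub_heap_rel_sym (x y : H) : sub_heap_rel S x y -> sub_heap_rel S y x.
Proof.
by case=> s Ss St; exists [h x, y, s]; rewrite // heap_opA heap_opyx heap_opxx.
Qed.

Lemma sub_heap_rel_trans (x y z : H) :
  sub_heap_rel S x y -> sub_heap_rel S y z -> sub_heap_rel S x z.
Proof.
move=> /sub_heap_relP[s [t [Ss St ->]]] /sub_heap_relP[s' [t' [Ss' St' ->]]].
by rewrite heap_opA; apply: sub_heap_rel_op => //; apply: hS.2.
Qed.

Lemma eqclass_sub_heap (s : H) : S s -> eqclass (sub_heap_rel S) s = S.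
Proof.
move=> Ss; apply/seteqP; split=> y /=.
  move=> /sub_heap_rel_sym/sub_heap_relP[s' [t' [Ss' St' ->]]].
  exact: hS.2.
by move=> Sy; exists s => //; apply: hS.2.
Qed.

End SubHeap.

Lemma sub_heap_rel_heap (H : abelianHeapType) (S : set H) :
  sub_heap S -> forall x x' y y' z z' : H,
  sub_heap_rel S x x' -> sub_heap_rel S y y' -> sub_heap_rel S z z' ->
  sub_heap_rel S [h x, y, z] [h x', y', z'].
Proof.
move=> hS x x' y y' z z' /sub_heap_relP[s [t [Ss St ->]]].
move=> /sub_heap_relP[s' [t' [Ss' St' ->]]] /sub_heap_relP[u [v [Su Sv ->]]].
rewrite -heap_opA abelian_heap_op_mid.
(* Reversing the inner bracket puts [v], [u] in front, and a second reversal restores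
   [[h x', y', z']]. The three shifts then merge into one, from [u] to [[h [h t, s, s'], t', v]]. *)
rewrite (heap_opC x') -(heap_opA v) (heap_opC z') 2!heap_opA.
by apply: sub_heap_rel_op => //; apply: hS.2 => //; apply: hS.2.
Qed.

Section Ideal.
Variables (T : trussType) (S : set T).
Hypothesis hS : ideal S.

(** All three arguments of each paragon bracket already lie in the ideal. *)
Lemma ideal_paragon : paragon S.
Proof.
have [[S0 Sop] Smul] := hS; split=> // x p p' Sp Sp'.
have [? ?] := Smul x p Sp; have [? ?] := Smul x p' Sp'.
by split; apply: Sop.
Qed.

Lemma ideal_sub_heap_rel_mul (x x' y y' : T) :
  sub_heap_rel S x x' -> sub_heap_rel S y y' ->
  sub_heap_rel S (x * y) (x' * y').
Proof.
have [Sh Smul] := hS => /sub_heap_relP[s [t [Ss St ->]]].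
move=> /sub_heap_relP[s' [t' [Ss' St' ->]]].
(* One factor is changed at a time, so that each step needs distributivity on one side only. *)
apply: (@sub_heap_rel_trans _ _ Sh _ (x' * [h t', s', y'])).
  by rewrite truss_mull; apply: sub_heap_rel_op; apply: (Smul _ _ _).2.
by rewrite truss_mulr; apply: sub_heap_rel_op; apply: (Smul _ _ _).1.
Qed.

Lemma ideal_congruence : congruence (sub_heap_rel S).
Proof.
have Sh := hS.1; split.
- exact: sub_heap_rel_refl.
- exact: sub_heap_rel_sym.
- exact: sub_heap_rel_trans.
- exact: sub_heap_rel_heap.
- exact: ideal_sub_heap_rel_mul.
Qed.

(** The products of [s] with [x] on either side stay in [S], and every element of [S] has class
    [S]. *)
Lemma ideal_absorber (C : congruence (sub_heap_rel S)) (s : T) :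
  S s -> absorber (to_quotient C s).
Proof.
have [Sh Smul] := hS => Ss A; elim/quotientP: A => x.
have [Sxs Ssx] := Smul x s Ss.
by rewrite !quotient_trussE; split; apply: quotient_inj;
   rewrite /= !eqclass_sub_heap.
Qed.

End Ideal.

Lemma absorber_unique (T : trussType) (o o' : T) :
  absorber o -> absorber o' -> o = o'.
Proof. by move=> ho ho'; rewrite -(ho o').1 (ho' o).2. Qed.

Theorem lemma3p26 (T : trussType) (S : set T) (hS : ideal S) :
  [/\ paragon S,
      congruence (sub_heap_rel S)
    & forall C : congruence (sub_heap_rel S),
        exists2 Z : quotient C, sval Z = S & unique (@absorber (quotient C)) Z].
Proof.
split; [exact: ideal_paragon | exact: ideal_congruence |] => C.
have [[s Ss] _] := hS.1; exists (to_quotient C s).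
  exact: (eqclass_sub_heap hS.1).
have absZ := @ideal_absorber _ _ hS C s Ss.
by split=> // Z; apply: absorber_unique.
Qed.
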